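(* Let $V$ and $V_n$, $n\in\mathbb{N}$, be potentials on $\Omega$. Assume that for all $f\in\mathbb{F}$ one has $\limsup_{n\to\infty}\mathbb{E}[V_nf]\le\mathbb{E}[Vf]$. Then for any $y\in\mathbb{R}^d$, $$\limsup_{n\to\infty}\Gamma_{V_n}(y)\le\Gamma_V(y).$$
   Context: Let $d\in\mathbb{N}$ and let $X=(\Omega,\mathcal{F},\mathbb{P},\tau)$ be a metric dynamical system: $(\Omega,\mathcal{F},\mathbb{P})$ is a probability space, $\tau:\mathbb{R}^d\times\Omega\to\Omega$, $(x,\omega)\mapsto\tau_x\omega$, is a product measurable action of the group $(\mathbb{R}^d,+)$ on $\Omega$, and $\mathbb{P}$ is invariant under $\tau_x$ for all $x\in\mathbb{R}^d$. $\mathbb{E}$ is expectation w.r.t. $\mathbb{P}$, $L^p=L^p(\Omega,\mathcal{F},\mathbb{P})$. A potential is a nonnegative $V\in L^1$. For measurable $f$ on $\Omega$ put $f_\omega(x):=f(\tau_x\omega)$. If $f_\omega$ is differentiable for all $\omega$, put $(Df)(\omega):=D(f_\omega)(0)$; $D^nf$, $\nabla f$ and $\nabla\cdot\phi$ are defined in the same way. Let $\mathbb{F}$ be the set of $f\in L^1$ such that $\mathbb{E}f=1$, there is $c_f>0$ with $f\ge c_f$, $f_\omega$ is differentiable of any order for all $\omega$, and $\sup_\Omega|D^nf|<\infty$ for all $n\in\mathbb{N}_0$. For $y\in\mathbb{R}^d$ let $\Phi_y$ be the set of $\phi\in(L^1)^d$ such that $\phi_\omega$ is differentiable of any order for all $\omega$,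 $\sup_\Omega|D^n\phi|<\infty$ for all $n\in\mathbb{N}_0$, $\mathbb{E}\phi=y$, and $\nabla\cdot\phi=0$ for all $\omega$. Define $$\Gamma_V(y):=2\inf_{f\in\mathbb{F}}\left[\left(\int\frac{|\nabla f|^2}{8f}+Vf\,d\mathbb{P}\right)\left(\inf_{\phi\in\Phi_y}\int\frac{|\phi|^2}{2f}\,d\mathbb{P}\right)\right]^{1/2}.$$ *)

(* Defs.v *)
From HB Require Import structures.
From mathcomp Require Export all_boot all_order all_algebra.
From mathcomp Require Export all_classical all_reals all_analysis.
Set Implicit Arguments.
Unset Strict Implicit.
Unset Printing Implicit Defensive.
Import Order.TTheory GRing.Theory Num.Theory.
Import numFieldNormedType.Exports.
Local Open Scope classical_set_scope.
Local Open Scope ring_scope.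

(* [g_sigma_algebraType open] carries the Borel sigma-algebra of R^d, so that
   [mds_measurable] is measurability for Borel(R^d) (x) F. *)
Record is_mds (R : realType) (d : nat) (disp : measure_display)
    (Omega : measurableType disp) (P : probability Omega R)
    (tau : 'rV[R]_d -> Omega -> Omega) : Prop := IsMds {
  mds_measurable : measurable_fun [set: _]
    (fun p : g_sigma_algebraType (@open 'rV[R]_d) * Omega => tau p.1 p.2);
  mds_act0 : forall w, tau 0 w = w;
  mds_actD : forall x y w, tau (x + y) w = tau x (tau y w);
  mds_invariant : forall x (A : set Omega), measurable A ->
    P (tau x @^-1` A) = P A }.

Definition is_L1 (R : realType) (disp : measure_display)
    (Omega : measurableType disp) (P : probability Omega R)
    (f : Omega -> R) : Prop := P.-integrable [set: Omega] (EFin \o f).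

Definition potential (R : realType) (disp : measure_display)
    (Omega : measurableType disp) (P : probability Omega R)
    (V : Omega -> R) : Prop := is_L1 P V /\ (forall w, 0 <= V w).

(* f_omega *)
Definition along (R : realType) (d : nat) (Omega T : Type)
    (tau : 'rV[R]_d -> Omega -> Omega) (f : Omega -> T) (w : Omega) :
  'rV[R]_d -> T := fun x => f (tau x w).

(* [iterD [:: v1; ...; vn] g x] is D^n g(x)[v1, ..., vn]: the n-th derivative is
   handled through its values as an n-linear form. *)
Definition iterD (R : realType) (d : nat) (W : normedModType R)
    (vs : seq 'rV[R]_d) (g : 'rV[R]_d -> W) : 'rV[R]_d -> W :=
  foldr (fun v (h : 'rV[R]_d -> W) => 'D_v h) g vs.

(* g is differentiable of any order iff g and all its iterated derivatives,
   evaluated on fixed directions, are (Frechet) differentiable everywhere. *)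
Definition smooth (R : realType) (d : nat) (W : normedModType R)
    (g : 'rV[R]_d -> W) : Prop :=
  forall (vs : seq 'rV[R]_d) (x : 'rV[R]_d), differentiable (iterD vs g) x.

(* |(D^n f)(omega)| as the norm of an n-linear form. [`| _ |] is the sup norm on
   R^d; as only the finiteness of suprema of this quantity matters, the choice of
   the norm is immaterial. *)
Definition normDn (R : realType) (d : nat) (Omega : Type) (W : normedModType R)
    (tau : 'rV[R]_d -> Omega -> Omega) (n : nat) (f : Omega -> W) (w : Omega) :
  \bar R :=
  ereal_sup [set `|iterD vs (along tau f w) 0|%:E
            | vs in [set vs : n.-tuple 'rV[R]_d |
                      forall i, `|tnth vs i| <= 1]].

Definition smooth_bounded (R : realType) (d : nat) (Omega : Type)
    (W : normedModType R) (tau : 'rV[R]_d -> Omega -> Omega) (f : Omega -> W) :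
  Prop :=
  (forall w, smooth (along tau f w)) /\
  (forall n, (ereal_sup (range (normDn tau n f)) < +oo)%E).

Definition grad (R : realType) (d : nat) (Omega : Type)
    (tau : 'rV[R]_d -> Omega -> Omega) (f : Omega -> R) (w : Omega) : 'rV[R]_d :=
  \row_i 'D_(delta_mx 0 i) (along tau f w) 0.

Definition divergence (R : realType) (d : nat) (Omega : Type)
    (tau : 'rV[R]_d -> Omega -> Omega) (phi : Omega -> 'rV[R]_d) (w : Omega) : R :=
  \sum_(i < d) ('D_(delta_mx 0 i) (along tau phi w) 0) 0 i.

(* squared Euclidean norm *)
Definition sqnorm (R : realType) (d : nat) (v : 'rV[R]_d) : R :=
  \sum_(i < d) v 0 i ^+ 2.

Definition densities (R : realType) (d : nat) (disp : measure_display)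
    (Omega : measurableType disp) (P : probability Omega R)
    (tau : 'rV[R]_d -> Omega -> Omega) : set (Omega -> R) :=
  [set f : Omega -> R | [/\ is_L1 P f,
               ('E_P[f] = 1)%E,
               exists c : R, 0 < c /\ (forall w, c <= f w) &
               smooth_bounded tau f]].

Definition flows (R : realType) (d : nat) (disp : measure_display)
    (Omega : measurableType disp) (P : probability Omega R)
    (tau : 'rV[R]_d -> Omega -> Omega) (y : 'rV[R]_d) :
  set (Omega -> 'rV[R]_d) :=
  [set phi : Omega -> 'rV[R]_d | [/\ forall i, is_L1 P (fun w => phi w 0 i),
                 smooth_bounded tau phi,
                 forall i, ('E_P[fun w => phi w 0%R i] = (y 0%R i)%:E)%E &
                 forall w, divergence tau phi w = 0]].

(* All integrands are nonnegative, so the integrals and infima are taken in the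
   extended reals; [sqrte] is the square root on [0, +oo]. *)
Definition Gamma (R : realType) (d : nat) (disp : measure_display)
    (Omega : measurableType disp) (P : probability Omega R)
    (tau : 'rV[R]_d -> Omega -> Omega) (V : Omega -> R) (y : 'rV[R]_d) :
  \bar R :=
  (2%:E * ereal_inf [set sqrte
     ((\int[P]_w (sqnorm (grad tau f w) / (8 * f w) + V w * f w)%:E) *
      ereal_inf [set \int[P]_w (sqnorm (phi w) / (2 * f w))%:E
                | phi in flows P tau y])
   | f in densities P tau])%E.

(* Main.v *)
(* An infimum of upper semicontinuous functions is upper semicontinuous. For fixed
   [f] the energy splits as G(f) + E[V f], and the infimum over the flows does not
   involve the potential; it is finite because the constant flow [y] is admissible,
   so multiplying by it is continuous. If r > Gamma_V(y), some density [f] has value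
   < r for V; by hypothesis it has value < r for V_n as soon as n is large, hence
   Gamma_{V_n}(y) <= r. *)
Require Import Defs.
From mathcomp Require Import measurable_realfun.
Import Order.TTheory GRing.Theory Num.Theory.
Import numFieldNormedType.Exports.
Local Open Scope classical_set_scope.
Local Open Scope ring_scope.

Lemma limn_esup_lt_near (R : realType) (u : (\bar R)^nat) (x : \bar R) :
  (limn_esup u < x)%E -> \forall n \near \oo, (u n < x)%E.
Proof.
rewrite /limn_esup limf_esupE => /ereal_inf_lt[_ [A Ainf <-]] supAx.
near=> n; apply: le_lt_trans supAx.
by apply: ereal_sup_ubound; exists n => //; near: n.
Unshelve. all: by end_near. Qed.

Lemma limn_esup_le_near (R : realType) (u : (\bar R)^nat) (x : \bar R) :
  (\forall n \near \oo, (u n <= x)%E) -> (limn_esup u <= x)%E.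
Proof.
move=> ux; rewrite /limn_esup limf_esupE.
apply: (@le_trans _ _ (ereal_sup (u @` [set n | (u n <= x)%E]))).
  by apply: ereal_inf_lbound; exists [set n | (u n <= x)%E].
by apply: ge_ereal_sup => _ [n /= unx <-].
Qed.

Lemma measurable_fun_inv_gt0 (disp : measure_display) (T : measurableType disp)
    (R : realType) (f : T -> R) :
  (forall x, 0 < f x) -> measurable_fun setT f ->
  measurable_fun setT (fun x => (f x)^-1).
Proof.
(* On positive reals the inverse is the power with exponent 1, inverted by [powR_inv1], which
   reduces the claim to [measurable_powR]. *)
move=> f0 mf; under eq_fun do rewrite -powR_inv1 ?ltW//.
exact: (measurableT_comp (measurable_powR _)).
Qed.

(** Nonnegativity excludes -oo and the strict inequality excludes +oo, so [x] is real; [x + 1]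
    serves when [y] is +oo. *)
Lemma ereal_between_real (R : realFieldType) (x y : \bar R) : (0 <= x < y)%E ->
  exists2 r, (x < r%:E)%E & (r%:E < y)%E.
Proof.
case: x y => [x||] [y||] //=; rewrite ?lee_fin ?lte_fin => /andP[x0 xy] //.
  by have [? ?] := midf_lt xy; exists ((x + y) / 2); rewrite lte_fin.
by exists (x + 1); rewrite ?ltry// lte_fin ltrDl.
Qed.

Lemma sqnorm_ge0 (R : realType) (d : nat) (v : 'rV[R]_d) : 0 <= sqnorm v.
Proof. by apply: sumr_ge0 => i _; exact: sqr_ge0. Qed.

Section MetricDynamicalSystem.
Context {R : realType} {d : nat} {disp : measure_display}
  {Omega : measurableType disp} (P : probability Omega R)
  (tau : 'rV[R]_d -> Omega -> Omega).

Lemma measurable_shift : is_mds P tau -> forall x, measurable_fun setT (tau x).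
Proof.
move=> [mtau _ _ _] x.
exact: (measurableT_comp mtau
  (pair1_measurable (x : g_sigma_algebraType (@open 'rV[R]_d)))).
Qed.

(** The derivative is the pointwise limit of difference quotients with step 1/(n+1), each measurable
    because [f] and every [tau x] are. *)
Lemma measurable_dirderiv (f : Omega -> R) (v : 'rV[R]_d) :
  is_mds P tau -> measurable_fun setT f ->
  (forall w, derivable (along tau f w) 0 v) ->
  measurable_fun setT (fun w => 'D_v (along tau f w) 0).
Proof.
move=> hX mf df.
(* The summand 0 and the double inverse reproduce the quotient defining ['D_v] at the step
   [n.+1%:R^-1]. *)
pose h n w : R := (n.+1%:R^-1)^-1 *:
  (f (tau (n.+1%:R^-1 *: v + 0) w) - f (tau 0 w)).
apply: (@measurable_fun_cvg _ _ _ _ h).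
  move=> n; rewrite /h; apply: measurable_funM => //.
  by apply: measurable_funB; apply: measurableT_comp => //;
    exact: measurable_shift.
move=> w _.
have dfw : h^-1 *: ((along tau f w \o shift 0) (h *: v) - along tau f w 0)
    @[h --> 0^'] --> 'D_v (along tau f w) 0 by exact: df.
apply: (@cvgr_dnbhsP _ _ _ _).1 dfw _ _; split=> [n|].
  by rewrite invr_eq0 pnatr_eq0.
exact: cvg_harmonic.
Qed.

Lemma measurable_sqnorm_grad (f : Omega -> R) :
  is_mds P tau -> densities P tau f ->
  measurable_fun setT (fun w => sqnorm (grad tau f w)).
Proof.
move=> hX [fL1 _ _ [sf _]]; apply: measurable_sum => i.
apply: measurable_funX.
under eq_fun do rewrite mxE.
apply: measurable_dirderiv => //.
  by apply/measurable_EFinP; exact: measurable_int fL1.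
by move=> w; apply: diff_derivable; exact: (sf w [::]).
Qed.

Lemma flows_cst (y : 'rV[R]_d) : flows P tau y (cst y).
Proof.
(* Each iterated derivative is [y] or 0: being constant gives smoothness, and the common bound [|y|]
   gives the finite suprema. *)
have Dcst (vs : seq 'rV[R]_d) : exists2 c : 'rV[R]_d, iterD vs (cst y) = cst c & `|c| <= `|y|.
  elim: vs => [|v vs [c ih cy]]; first by exists y.
  exists 0; last by rewrite normr0.
  by rewrite /= ih; apply/funext => x; rewrite derive_cst.
split.
- by move=> i; exact: finite_measure_integrable_cst.
- split.
    move=> w vs x; have [c] := Dcst vs.
    rewrite /along /= => -> _; exact: differentiable_cst.
  move=> n; apply: (@le_lt_trans _ _ `|y|%:E); last exact: ltry.
  apply: ge_ereal_sup => _ [w _ <-]; apply: ge_ereal_sup => _ [vs _ <-].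
  by rewrite lee_fin; have [c] := Dcst vs; rewrite /along /= => ->.
- by move=> i; rewrite expectation_cst.
- move=> w; rewrite /divergence big1// => i _.
  by rewrite (_ : along _ _ _ = cst y)// derive_cst mxE.
Qed.

(** The factor of [Gamma] free of the potential, kept verbatim so that [Gamma] unfolds to it by
    conversion. *)
Definition kinetic (f : Omega -> R) (y : 'rV[R]_d) : \bar R :=
  (ereal_inf [set \int[P]_w (sqnorm (phi w) / (2 * f w))%:E
             | phi in flows P tau y])%E.

Lemma kinetic_ge0 (f : Omega -> R) (y : 'rV[R]_d) :
  densities P tau f -> (0 <= kinetic f y)%E.
Proof.
move=> [_ _ [c [c0 cf]] _]; apply: le_ereal_inf_tmp => _ [phi _ <-].
apply: integral_ge0 => w _; rewrite lee_fin divr_ge0 ?sqnorm_ge0//.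
by rewrite mulr_ge0// (le_trans (ltW c0)).
Qed.

(** The constant flow competes, and [c <= f] bounds its integrand by a constant, which has finite
    integral under a probability. *)
Lemma kinetic_lty (f : Omega -> R) (y : 'rV[R]_d) :
  densities P tau f -> (kinetic f y < +oo)%E.
Proof.
move=> [fL1 _ [c [c0 cf]] _].
apply: (@le_lt_trans _ _ (\int[P]_w (sqnorm y / (2 * f w))%:E)%E).
  by apply: ereal_inf_lbound; exists (cst y) => //; exact: flows_cst.
apply: (@le_lt_trans _ _ (\int[P]_w (sqnorm y / (2 * c))%:E)%E).
  have f0 w : 0 < f w by exact: lt_le_trans (cf w).
  apply: ge0_le_integral => //.
  - by move=> w _; rewrite lee_fin divr_ge0 ?sqnorm_ge0 ?mulr_ge0// ltW.
  - apply/measurable_EFinP/measurable_funM => //.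
    apply: measurable_fun_inv_gt0 => [w|]; first by rewrite mulr_gt0.
    apply: measurable_funM => //.
    by apply/measurable_EFinP; exact: measurable_int fL1.
  - move=> w _; rewrite lee_fin ler_wpM2l ?sqnorm_ge0//.
    by rewrite lef_pV2 ?posrE ?mulr_gt0// ler_pM2l.
rewrite integral_cst//; apply: lte_mul_pinfty => //.
  by rewrite lee_fin divr_ge0 ?sqnorm_ge0 ?mulr_ge0// ltW.
by rewrite ltey_eq fin_num_measure.
Qed.

(** Additivity for nonnegative measurable integrands, where either term may be +oo. *)
Lemma energyE (V f : Omega -> R) : is_mds P tau -> potential P V ->
  densities P tau f ->
  (\int[P]_w (sqnorm (grad tau f w) / (8 * f w) + V w * f w)%:E =
   \int[P]_w (sqnorm (grad tau f w) / (8 * f w))%:E +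
   'E_P[(fun w => V w * f w)%R])%E.
Proof.
move=> hX [VL1 V0] df; have mg := measurable_sqnorm_grad f hX df.
move: df => [fL1 _ [c [c0 cf]] _].
have f0 w : 0 < f w by exact: lt_le_trans (cf w).
have mf : measurable_fun setT f.
  by apply/measurable_EFinP; exact: measurable_int fL1.
have mV : measurable_fun setT V.
  by apply/measurable_EFinP; exact: measurable_int VL1.
rewrite unlock; under eq_integral do rewrite EFinD.
rewrite ge0_integralD//.
- by move=> w _; rewrite lee_fin divr_ge0 ?sqnorm_ge0 ?mulr_ge0// ltW.
- apply/measurable_EFinP/measurable_funM => //.
  apply: measurable_fun_inv_gt0 => [w|]; first by rewrite mulr_gt0.
  exact: measurable_funM.
- by move=> w _; rewrite lee_fin mulr_ge0// ltW.
- by apply/measurable_EFinP; exact: measurable_funM.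
Qed.

End MetricDynamicalSystem.

Theorem proposition4p3 (R : realType) (d : nat) (hd : (0 < d)%N)
    (disp : measure_display) (Omega : measurableType disp)
    (P : probability Omega R) (tau : 'rV[R]_d -> Omega -> Omega)
    (hX : is_mds P tau)
    (V : Omega -> R) (Vn : nat -> Omega -> R)
    (hV : potential P V) (hVn : forall n, potential P (Vn n))
    (hlim : forall f : Omega -> R, densities P tau f ->
       (limn_esup (fun n => 'E_P[(fun w => Vn n w * f w)%R])
          <= 'E_P[(fun w => V w * f w)%R])%E)
    (y : 'rV[R]_d) :
  (limn_esup (fun n => Gamma P tau (Vn n) y) <= Gamma P tau V y)%E.
Proof.
rewrite leNgt; apply/negP => lt1.
have Gamma0 : (0 <= Gamma P tau V y)%E.
  rewrite mule_ge0//; apply: le_ereal_inf_tmp => _ [f _ <-].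
  exact: sqrte_ge0.
have [r Vr] : exists2 r, (Gamma P tau V y < r%:E)%E &
    (r%:E < limn_esup (fun n => Gamma P tau (Vn n) y))%E.
  by apply: ereal_between_real; rewrite Gamma0.
apply/negP; rewrite -leNgt; apply: limn_esup_le_near.
have r0 : 0 < r by rewrite -lte_fin; exact: le_lt_trans Vr.
have GammaE U : Gamma P tau U y = (2%:E * ereal_inf [set sqrte
    ((\int[P]_w (sqnorm (grad tau f w) / (8 * f w) + U w * f w)%:E) *
     kinetic P tau f y) | f in densities P tau])%E by [].
have : (ereal_inf [set sqrte
    ((\int[P]_w (sqnorm (grad tau f w) / (8 * f w) + V w * f w)%:E) *
     kinetic P tau f y) | f in densities P tau] < (2^-1 * r)%:E)%E.
  by rewrite EFinM lte_pdivlMl// -GammaE.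
move=> /ereal_inf_lt[_ [f df <-]].
set b := kinetic P tau f y => fr.
have [c [c0 cf]] : exists c : R, 0 < c /\ (forall w, c <= f w) by case: df.
have f0 w : 0 < f w by exact: lt_le_trans (cf w).
have q0 : 0 <= 2^-1 * r by rewrite mulr_ge0 ?invr_ge0 ?ltW.
(* As a square root, the bound can be compared under [sqrte], by monotonicity. *)
have sqrtq : (2^-1 * r)%:E = sqrte (((2^-1 * r) ^+ 2)%:E).
  by rewrite EFin_expe sqrte_sqr gee0_abs.
suff : \forall n \near \oo,
    ((\int[P]_w (sqnorm (grad tau f w) / (8 * f w))%:E +
      'E_P[(fun w => Vn n w * f w)%R]) * b < ((2^-1 * r) ^+ 2)%:E)%E.
  apply: filterS => n /ltW le_n; rewrite GammaE -lee_pdivlMl//.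
  apply: (@le_trans _ _ (sqrte
      (\int[P]_w (sqnorm (grad tau f w) / (8 * f w) + Vn n w * f w)%:E * b))).
    by apply: ereal_inf_lbound; exists f.
  by rewrite -EFinM sqrtq lee_sqrt ?lee_fin ?sqr_ge0// energyE.
have boo : (b < +oo)%E by exact: kinetic_lty.
have : (0 <= b)%E by exact: kinetic_ge0.
have : ((\int[P]_w (sqnorm (grad tau f w) / (8 * f w))%:E +
      'E_P[(fun w => V w * f w)%R]) * b < ((2^-1 * r) ^+ 2)%:E)%E.
  (* [lee_sqrt] is a weak comparison, so the strict one goes by contradiction; the negated bound
     also gives the sign of the product. *)
  rewrite -energyE// ltNge; apply/negP => ge_q.
  move: fr; rewrite ltNge sqrtq lee_sqrt ?ge_q//.
  by rewrite (le_trans _ ge_q)// lee_fin sqr_ge0.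
case: b boo {fr} => [b| |]// _; rewrite lee_fin le_eqVlt => Vb /predU1P[<-|b0].
  (* If [b] is 0, the product is 0 even for infinite energy, and [r > 0] suffices. *)
  by apply: nearW => n; rewrite mule0 lte_fin exprn_gt0// mulr_gt0.
move: Vb; rewrite -lte_pdivlMr// -EFinM.
set G := (\int[P]_w _)%E.
have G0 : (0 <= G)%E.
  apply: integral_ge0 => w _; rewrite lee_fin divr_ge0 ?sqnorm_ge0//.
  by rewrite mulr_ge0// ltW.
have V0 : (0 <= 'E_P[(fun w => V w * f w)%R])%E.
  rewrite unlock; apply: integral_ge0 => w _.
  by rewrite lee_fin mulr_ge0//; [exact: hV.2|exact: ltW].
move=> GV.
(* Finiteness allows [G] to be moved across the inequality; it follows from [G <= G + E[V f]], a sum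
   with a real upper bound. *)
have Gfin : G \is a fin_num.
  rewrite ge0_fin_numE//; apply: le_lt_trans (lt_trans GV (ltry _)).
  exact: leeDl.
(* Only E[V f] remains on the left, so [hlim] applies; the same rearrangements are then undone for
   each large [n]. *)
move: GV; rewrite -lteBrDl// => /(le_lt_trans (hlim f df))/limn_esup_lt_near.
by apply: filterS => n; rewrite lteBrDl// -lte_pdivlMr// EFinM.
Qed.
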